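(* (Restricted sum formula) For any positive integers $k,n,m$ with $k\ge n$, $$\sum_{\substack{k_1+\cdots+k_n=k\\ k_i\ge1}}\zeta^t(2mk_1,\ldots,2mk_n)=\left\{\sum_{i=1}^n\left[\sum_{j=0}^{k-i}\binom{k-j}{i}\sum_{\substack{n_0+\cdots+n_{m-1}=mj,\ l_0+\cdots+l_{m-1}=m(k-j)\\ n_p,l_p\ge0}}\prod_{p=0}^{m-1}\frac{\beta_{2n_p}}{(2n_p)!(2l_p+1)!}\,\rho_m^{\sum_{p=0}^{m-1}2p(n_p+l_p)}\right](-1)^i\binom{k-i}{k-n}t^{n-i}\right\}\frac{\lambda^{2km}}{4^{km}},$$ where $\rho_m=e^{\pi\sqrt{-1}/m}$, $\lambda=2\pi\sqrt{-1}$ and $\beta_{2l}=B_{2l}(2-4^l)$.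
   Context: $B_n$ are the Bernoulli numbers, $u/(e^u-1)=\sum_{n\ge0}B_nu^n/n!$; $t$ is a variable. For positive integers with $k_1\ge2$, $\zeta(k_1,\ldots,k_n)=\sum_{m_1>\cdots>m_n>0}\prod m_j^{-k_j}$ and the interpolated multiple zeta value is $\zeta^t(k_1,\ldots,k_n)=\sum_{\mathbf p}t^{n-\mathrm{dep}(\mathbf p)}\zeta(\mathbf p)$, summed over all sequences $\mathbf p$ obtained from $(k_1,\ldots,k_n)$ by replacing each separating comma by either a comma or a plus sign ($\mathrm{dep}$ = length). *)

(* Defs.v *)
From HB Require Import structures.
From mathcomp Require Import all_boot all_order all_algebra.
From mathcomp Require Import all_classical all_reals all_analysis.
From mathcomp Require Import complex.
Set Implicit Arguments. Unset Strict Implicit. Unset Printing Implicit Defensive.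
Import Order.TTheory GRing.Theory Num.Theory numFieldNormedType.Exports.
Local Open Scope ring_scope.

(* u/(e^u-1) = sum B_n u^n/n!  is equivalent (comparing coefficients in
   u = (e^u - 1) * sum B_n u^n/n!) to B_0 = 1 and
   sum_{j=0}^{n} 'C(n+1, j) B_j = 0 for n >= 1, i.e.
   B_{n+1} = - (sum_{j<=n} 'C(n+2, j) B_j) / (n+2).                       *)
Fixpoint bernoulli_seq (n : nat) : seq rat :=
  match n with
  | 0 => [:: 1]
  | n'.+1 =>
      let s := bernoulli_seq n' in
      rcons s (- (\sum_(j < n'.+1) ('C(n'.+2, j))%:R * nth 0 s j) / (n'.+2)%:R)
  end.

Definition bernoulli (n : nat) : rat := nth 0 (bernoulli_seq n) n.

Definition beta2 (l : nat) : rat := bernoulli (2 * l) * (2 - (4 ^ l)%:R).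

Fixpoint mzv_trunc {R : realType} (ks : seq nat) (N : nat) : R :=
  match ks with
  | [::] => 1
  | k :: ks' => \sum_(1 <= m < N.+1) (m%:R ^- k) * mzv_trunc ks' m.-1
  end.

Definition mzv {R : realType} (ks : seq nat) : R :=
  limn ((fun N : nat => @mzv_trunc R ks N) : R^nat).

(* merging: bit b_i = true means the i-th separating comma becomes a plus *)
Fixpoint mzv_merge (x : nat) (xs : seq nat) (bs : seq bool) : seq nat :=
  match xs, bs with
  | y :: ys, b :: bs' => if b then mzv_merge (x + y) ys bs'
                         else x :: mzv_merge y ys bs'
  | _, _ => [:: x]
  end.

Definition mzv_t {R : realType} (t : R[i]) (ks : seq nat) : R[i] :=
  match ks with
  | [::] => 1
  | x :: xs =>
      \sum_(b : (size xs).-tuple bool)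
        t ^+ (size ks - size (mzv_merge x xs b)) *
        ((@mzv R (mzv_merge x xs b))%:C)%C
  end.

Definition rho {R : realType} (m : nat) : R[i] :=
  (cos (pi / m%:R) +i* sin (pi / m%:R))%C.

Definition lambda {R : realType} : R[i] := ((0 : R) +i* (2 * pi))%C.

(* Main.v *)
Require Import Defs.
From HB Require Import structures.
From mathcomp Require Import all_boot all_order all_algebra.
From mathcomp Require Import all_classical all_reals all_analysis.
From mathcomp Require Import complex.
From mathcomp Require Import ring lra zify.
Import Order.TTheory GRing.Theory Num.Theory numFieldNormedType.Exports.
Local Open Scope ring_scope.
Set Implicit Arguments. Unset Strict Implicit. Unset Printing Implicit Defensive.

(** Put [A(w) = prod_r (1 - w / r^(2m))]. In [sum_(k,n) S(k,n) z^k y^n], where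
    [S(k,n)] is the left-hand side of the theorem, an integer [r] carrying a
    merged block contributes
    [sum_(d >= 1) t^(d-1) (y x / (1 - x))^d = y x / (1 - (1 + t y) x)] with
    [x = z / r^(2m)], so the generating function is
    [A((1 + t y - y) z) / A((1 + t y) z)]. Expanding the numerator around
    [1 + t y] gives the binomials, once the coefficients of [A] and [1 / A] are
    known. Since [A(v^m) = prod_(p < m) A_1(rho^(2p) v)], where
    [A_1(v) = prod_r (1 - v / r^2) = sin (pi sqrt v) / (pi sqrt v)], these come
    from the series of [sin x / x] and [x / sin x]. The coefficients of [A_1]
    are obtained elementarily: the elementary symmetric functions of
    [cot^2 (r pi / (2N+1))], [1 <= r <= N], are explicit binomials, and
    [cot^2 x <= 1 / x^2 <= 1 + cot^2 x]. The identities are first proved for the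
    sums and products over [r <= N]; then [N] tends to infinity. *)

(** * Bernoulli numbers and truncated power series *)

(** Congruence modulo ['X^D]: power series identities are stated for polynomials up to this
    relation. *)
Definition eqX (A : nzRingType) (D : nat) (P Q : {poly A}) :=
  forall i, (i < D)%N -> P`_i = Q`_i.

Lemma eqXM (A : nzRingType) D (P P' Q Q' : {poly A}) :
  eqX D P P' -> eqX D Q Q' -> eqX D (P * Q) (P' * Q').
Proof.
move=> eP eQ i iD; rewrite !coefM; apply: eq_bigr => j _.
by rewrite eP ?eQ //; have := ltn_ord j; lia.
Qed.

Lemma eqX_prod (A : nzRingType) D (I : Type) (r : seq I) (P Q : I -> {poly A}) :
  (forall p, eqX D (P p) (Q p)) ->
  eqX D (\prod_(p <- r) P p) (\prod_(p <- r) Q p).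
Proof.
by move=> ePQ; apply: (big_ind2 (eqX D)) => // *; apply: eqXM.
Qed.

(** Coefficient [N] sees each factor only up to degree [N]. Distributing the product of the
    truncations leaves the choice functions of total degree [N], which index the inner sums of the
    theorem. *)
Lemma coef_prod_ffun (A : comNzRingType) (m N : nat) (P : 'I_m -> {poly A}) :
  (\prod_(p < m) P p)`_N =
  \sum_(c : {ffun 'I_m -> 'I_N.+1} | (\sum_(p < m) (c p : nat))%N == N)
     \prod_(p < m) (P p)`_(c p).
Proof.
have -> : (\prod_(p < m) P p)`_N =
    (\prod_(p < m) \sum_(i < N.+1) (P p)`_i *: 'X^i)`_N.
  apply: (@eqX_prod _ N.+1) => // p i iN.
  by rewrite -poly_def coef_poly iN.
rewrite bigA_distr_bigA coef_sum [RHS]big_mkcond; apply: eq_bigr => c _ /=.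
rewrite scaler_prod coefZ prodrXr coefXn eq_sym.
by case: eqP; rewrite ?mulr1 ?mulr0.
Qed.

Lemma size_bernoulli_seq n : size (bernoulli_seq n) = n.+1.
Proof. by elim: n => //= n IH; rewrite size_rcons IH. Qed.

Lemma nth_bernoulli_seq n j :
  (j <= n)%N -> nth 0 (bernoulli_seq n) j = bernoulli j.
Proof.
elim: n => [|n IH]; first by case: j.
rewrite leq_eqVlt => /orP[/eqP-> //|jn] /=.
by rewrite nth_rcons size_bernoulli_seq jn IH.
Qed.

Lemma sum_bin_bernoulli n :
  \sum_(j < n) 'C(n, j)%:R * bernoulli j = (n == 1%N)%:R.
Proof.
case: n => [|[|n]]; first by rewrite big_ord0.
  by rewrite big_ord1 bin0 mul1r.
rewrite big_ord_recr /=.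
have -> : bernoulli n.+1 =
    - (\sum_(j < n.+1) 'C(n.+2, j)%:R * bernoulli j) / n.+2%:R.
  rewrite /bernoulli /= nth_rcons size_bernoulli_seq ltnn eqxx.
  congr (- _ / _); apply: eq_bigr => j _.
  by rewrite nth_bernoulli_seq // -ltnS.
by rewrite binSn mulrC divfK ?subrr // pnatr_eq0.
Qed.

Definition exp_poly (D : nat) (c : rat) : {poly rat} :=
  \poly_(n < D) (c ^+ n / n`!%:R).

Definition bernoulli_poly (D : nat) (c : rat) : {poly rat} :=
  \poly_(n < D) (bernoulli n * c ^+ n / n`!%:R).

Lemma fact_neq0 n : n`!%:R != 0 :> rat.
Proof. by rewrite pnatr_eq0 -lt0n fact_gt0. Qed.

Lemma bin_factV n i : (i <= n)%N ->
  'C(n, i)%:R / n`!%:R = (i`!%:R)^-1 * ((n - i)`!%:R)^-1 :> rat.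
Proof.
move=> le_in; rewrite -(bin_fact le_in) !natrM.
by field; rewrite !fact_neq0 pnatr_eq0 -lt0n bin_gt0 le_in.
Qed.

Lemma exp_polyD D c d :
  eqX D (exp_poly D c * exp_poly D d) (exp_poly D (c + d)).
Proof.
move=> n nD; rewrite coefM coef_poly nD addrC exprDn mulr_suml.
apply: eq_bigr => i _; have le_in : (i <= n)%N by rewrite -ltnS.
rewrite !coef_poly !ifT; try lia.
rewrite -[_ *+ 'C(_, _)]mulr_natr -[RHS]mulrA bin_factV //; ring.
Qed.

Lemma exp_poly0 D : eqX D (exp_poly D 0) 1.
Proof.
by move=> n nD; rewrite coef_poly nD coef1 expr0n; case: n nD => //= n _; rewrite mul0r.
Qed.

(** The equation [B(u) (e^u - 1) = u] at [u = c X]. Subtracting 1 removes the last term of each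
    convolution, which leaves the sum over [j < n] of [sum_bin_bernoulli]. *)
Lemma bernoulli_polyP D c :
  eqX D (bernoulli_poly D c * (exp_poly D c - 1)) (c *: 'X).
Proof.
move=> n nD; rewrite coefM coefZ coefX big_ord_recr /=.
rewrite coefB coef1 [(exp_poly D c)`__]coef_poly subnn ifT ?(leq_ltn_trans _ nD) //.
rewrite expr0 divr1 subrr mulr0 addr0.
have -> : c * (n == 1%N)%:R = c ^+ n * (n == 1%N)%:R / n`!%:R.
  by case: n {nD} => [|[|n]]; rewrite ?mulr0 ?mul0r ?mulr1 ?divr1.
rewrite -sum_bin_bernoulli mulr_sumr mulr_suml; apply: eq_bigr => i _.
have le_in : (i < n)%N by [].
rewrite coefB coef1 !coef_poly !ifT; try lia.
have -> : (n - i == 0)%N = false by lia.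
have -> : c ^+ n = c ^+ i * c ^+ (n - i) by rewrite -exprD subnKC // ltnW.
rewrite subr0.
transitivity (c ^+ i * c ^+ (n - i) * bernoulli i * ('C(n, i)%:R / n`!%:R)).
  by rewrite bin_factV 1?ltnW //; ring.
ring.
Qed.

Lemma sum_ord_double (V : nmodType) n (f : nat -> V) :
  \sum_(i < 2 * n) f i = \sum_(j < n) (f (2 * j)%N + f (2 * j).+1).
Proof.
elim: n => [|n IH]; first by rewrite muln0 !big_ord0.
by rewrite mulnS addnC addn2 !big_ord_recr /= IH addrA.
Qed.

Lemma eqXB (A : nzRingType) D (P P' Q Q' : {poly A}) :
  eqX D P P' -> eqX D Q Q' -> eqX D (P - Q) (P' - Q').
Proof. by move=> eP eQ i iD; rewrite !coefB eP ?eQ. Qed.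

Lemma eqX_trans (A : nzRingType) D (Q P S : {poly A}) :
  eqX D P Q -> eqX D Q S -> eqX D P S.
Proof. by move=> h1 h2 i iD; rewrite h1 ?h2. Qed.

Lemma eqX_sym (A : nzRingType) D (P Q : {poly A}) : eqX D P Q -> eqX D Q P.
Proof. by move=> h i iD; rewrite h. Qed.

(* [x / sinh x = 2 B(x) - B(2x)] with [B(u) = u / (e^u - 1)]. *)
Lemma bernoulli_sinh D :
  eqX D ((2 *: bernoulli_poly D 1 - bernoulli_poly D 2) *
         (exp_poly D 1 - exp_poly D (- 1))) (2 *: 'X).
Proof.
set B1 := bernoulli_poly D 1; set B2 := bernoulli_poly D 2.
set E := exp_poly D 1; set F := exp_poly D (- 1); set E2 := exp_poly D 2.
have EF : eqX D (E * F) 1.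
  apply: (eqX_trans (@exp_polyD D 1 (- 1))).
  by rewrite subrr; apply: exp_poly0.
have EE : eqX D (E * E) E2 by apply: exp_polyD.
have h1 : eqX D (B1 * (E - 1)) 'X.
  by rewrite -[X in eqX _ _ X]scale1r; apply: bernoulli_polyP.
have h2 : eqX D (B2 * (E * E - 1)) (2 *: 'X).
  apply: (eqX_trans _ (@bernoulli_polyP D 2)).
  by apply: eqXM => //; apply: eqXB.
(* Since [e^(2x) - 1 = (e^x - 1) (e^x + 1)], both Bernoulli equations apply after this step; what
   remains is [(2x (e^x + 1) - 2x) e^(-x) = 2x]. *)
have eE : eqX D (E - F) ((E * E - 1) * F).
  rewrite mulrBl mul1r -mulrA; apply: eqXB => //.
  by rewrite -{1}[E]mulr1; apply: eqXM => //; apply: eqX_sym.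
apply: (@eqX_trans _ _ ((2 *: B1 - B2) * ((E * E - 1) * F))).
  by apply: eqXM.
rewrite !scaler_nat in h2 *.
have -> : (B1 *+ 2 - B2) * ((E * E - 1) * F) =
  ((B1 * (E - 1)) * ((E + 1) *+ 2) - B2 * (E * E - 1)) * F by ring.
apply: (@eqX_trans _ _ (('X * ((E + 1) *+ 2) - 'X *+ 2) * F)).
  by apply: eqXM => //; apply: eqXB => //; apply: eqXM.
have -> : ('X * ((E + 1) *+ 2) - 'X *+ 2) * F = 'X *+ 2 * (E * F) by ring.
by rewrite -[X in eqX _ _ X]mulr1; apply: eqXM.
Qed.

(** The coefficient of [x^(2k+1)] in [bernoulli_sinh], halved. As [e^x - e^(-x)] is odd, only even
    indices of the first factor survive, and there [2 B_(2j) - 4^j B_(2j)] is [beta2 j]. *)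
Lemma beta2_sinh k :
  \sum_(j < k.+1) beta2 j / (2 * j)`!%:R * ((2 * (k - j)).+1`!%:R)^-1
    = (k == 0%N)%:R.
Proof.
have := @bernoulli_sinh (2 * k).+2 (2 * k).+1 (leqnn _).
rewrite coefM coefZ coefX.
have -> : (2 * k).+2 = (2 * k.+1)%N by lia.
set f := fun i : nat =>
  (2 *: bernoulli_poly (2 * k.+1) 1 - bernoulli_poly (2 * k.+1) 2)`_i *
  (exp_poly (2 * k.+1) 1 - exp_poly (2 * k.+1) (-1))`_((2 * k).+1 - i).
rewrite (@sum_ord_double _ k.+1 f) => e.
have -> : (k == 0)%:R = 2^-1 * (2 * ((2 * k).+1 == 1%N)%:R) :> rat.
  have -> : ((2 * k).+1 == 1 = (k == 0))%N by lia.
  by rewrite mulKf.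
rewrite -e mulr_sumr; apply: eq_bigr => j _; have jk := ltn_ord j.
rewrite /f !coefB !coefZ !coef_poly !ifT; try lia.
have -> : ((2 * k).+1 - 2 * j)%N = (2 * (k - j)).+1 by lia.
have -> : ((2 * k).+1 - (2 * j).+1)%N = (2 * (k - j))%N by lia.
rewrite !expr1n !exprS !exprM sqrrN !expr1n subrr mulr0 addr0.
have -> : 2 ^+ 2 = 4 :> rat by [].
rewrite /beta2 natrX.
by field; rewrite !fact_neq0.
Qed.

(** * Roots of unity *)

Lemma prim_rootV (F : fieldType) m (w : F) :
  m.-primitive_root w -> m.-primitive_root w^-1.
Proof.
case/andP=> m0 wP; rewrite /primitive_root_of_unity m0 /=.
apply/forallP => i; rewrite -(eqP (forallP wP i)).
by rewrite !unity_rootE exprVn invr_eq1.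
Qed.

(** As [1 - w^p X = - w^p (X - w^(-p))], the product is a constant times [X^m - 1], factored over
    the powers of [w^-1]; evaluation at 0 gives the constant. *)
Lemma prod_one_sub_prim_root (F : fieldType) m (w : F) :
  (0 < m)%N -> m.-primitive_root w ->
  \prod_(p < m) (1 - w ^+ p *: 'X) = 1 - 'X^m :> {poly F}.
Proof.
move=> m0 wP; have w0 : w != 0 by rewrite (prim_root_eq0 wP) -lt0n.
pose c := \prod_(p < m) - w ^+ p.
have e : \prod_(p < m) (1 - w ^+ p *: 'X) = c *: ('X^m - 1).
  rewrite -(factor_Xn_sub_1 (prim_rootV wP)) big_mkord -scaler_prod.
  apply: eq_bigr => p _.
  rewrite scalerBr !scaleNr opprK -[_ *: _%:P]mul_polyC -polyCM exprVn.
  by rewrite divff ?expf_neq0 // addrC.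
have := congr1 (horner^~ 0) e.
rewrite horner_prod big1 => [|p _]; last by rewrite hornerD hornerN hornerZ hornerX hornerC mulr0 subr0.
rewrite !hornerE expr0n gtn_eqF //= sub0r mulrN1 => c1.
by rewrite e -[c]opprK -c1 scaleN1r opprB.
Qed.

(** * The generating function of truncated sums *)

Fixpoint compositions (n k : nat) : seq (seq nat) :=
  if n is n'.+1 then
    [seq i.+1 :: s | i <- iota 0 k, s <- compositions n' (k - i.+1)]
  else if k is 0 then [:: [::]] else [::].

Lemma mem_compositions n k s :
  (s \in compositions n k) =
  [&& size s == n, all (fun x => 0 < x)%N s & sumn s == k].
Proof.
elim: n k s => [|n IH] k s.
  by case: s => [|x s]; case: k => [|k].
case: s => [|x s] /=; first by apply/allpairsPdep => -[i [s []]].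
apply/allpairsPdep/and3P => [[i [s' []]]|[/eqP sn /andP[x0 s0] /eqP sk]].
  rewrite mem_iota /= add0n IH => ik /and3P[/eqP <- s'0 /eqP s'k] [-> ->].
  by rewrite eqxx s'0 s'k subnKC.
exists x.-1, s; rewrite prednK // mem_iota IH s0; split => //; first by lia.
by case: sn => ->; rewrite -sk addKn !eqxx.
Qed.

Lemma uniq_compositions n k : uniq (compositions n k).
Proof.
elim: n k => [|n IH] [|k] //.
apply: allpairs_uniq_dep; first exact: iota_uniq.
  by move=> i _; apply: IH.
by move=> [i s] [j s'] _ _ /= [-> ->].
Qed.

Lemma compositions_gt n k : (k < n)%N -> compositions n k = [::].
Proof.
move=> kn; apply/nilP; rewrite /nilp -leqn0 leqNgt; apply/negP => h.
have := mem_nth [::] h; rewrite mem_compositions => /and3P[/eqP s1 s2 /eqP s3].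
have : (size (nth [::] (compositions n k) 0) <= sumn (nth [::] (compositions n k) 0))%N.
  by elim: (nth _ _ _) s2 => //= x s IHs /andP[x0 /IHs]; lia.
by rewrite s1 s3; lia.
Qed.

Lemma sum_compositions (V : nmodType) (f : seq nat -> V) n k :
  \sum_(c : {ffun 'I_n -> 'I_k.+1} |
      [forall i, (0 < c i)%N] && ((\sum_(i < n) (c i : nat))%N == k))
    f [seq (c i : nat) | i : 'I_n] =
  \sum_(s <- compositions n k) f s.
Proof.
pose P (c : {ffun 'I_n -> 'I_k.+1}) :=
  [forall i, (0 < c i)%N] && ((\sum_(i < n) (c i : nat))%N == k).
pose lst (c : {ffun 'I_n -> 'I_k.+1}) := [seq (c i : nat) | i : 'I_n].
transitivity (\sum_(c <- enum P) f (lst c)); first by rewrite big_enum.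
rewrite -(big_map lst xpredT f) /=.
apply: perm_big; apply: uniq_perm.
- rewrite map_inj_uniq ?enum_uniq // => c d /eq_in_map cd.
  by apply/ffunP => i; apply/val_inj/cd; rewrite mem_enum.
- exact: uniq_compositions.
move=> s; rewrite mem_compositions; apply/mapP/and3P.
  case=> c; rewrite mem_enum => /andP[/forallP c0 /eqP ck] ->.
  rewrite /lst /image_mem size_map size_enum_ord; split => //.
    by apply/allP => x /mapP[i _ ->].
  by rewrite sumnE big_map big_enum /= ck.
case=> /eqP sn s0 /eqP sk.
(* This bound lets [inord] below keep the value of every entry. *)
have le_s i : (nth 0 s i <= k)%N.
  have [h|h] := ltnP i (size s); last by rewrite nth_default.
  rewrite -sk sumnE (big_nth 0%N) big_mkord (bigD1 (Ordinal h)) //=.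
  by rewrite leq_addr.
pose c := [ffun i : 'I_n => inord (nth 0%N s i) : 'I_k.+1].
have cE i : c i = nth 0%N s i :> nat by rewrite ffunE inordK // ltnS.
exists c; last first.
  apply: (@eq_from_nth _ 0%N); first by rewrite size_map size_enum_ord.
  rewrite sn => i ilt; rewrite (nth_map (Ordinal ilt)) ?size_enum_ord //.
  by rewrite cE nth_enum_ord.
rewrite mem_enum; apply/andP; split.
  by apply/forallP => i; rewrite cE; apply: (allP s0); apply: mem_nth; rewrite sn.
rewrite -[X in _ == X]sk sumnE (big_nth 0%N) big_mkord sn; apply/eqP.
by apply: eq_bigr => i _; rewrite cE.
Qed.

(** * Weighted sums over mergings *)

Section MergeSum.
Variables (K : comNzRingType) (t : K).

(** The sum in [mzv_t] for an arbitrary [f], so that it also covers truncated sums. *)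
Definition merge_sum (f : seq nat -> K) (ks : seq nat) : K :=
  match ks with
  | [::] => f [::]
  | x :: xs => \sum_(b : (size xs).-tuple bool)
      t ^+ (size ks - size (mzv_merge x xs b)) * f (mzv_merge x xs b)
  end.

Lemma size_mzv_merge x xs bs : (size (mzv_merge x xs bs) <= (size xs).+1)%N.
Proof.
elim: xs x bs => [|y ys IH] x [|b bs] //=.
by case: b => /=; rewrite ?ltnS // ltnW // ltnS.
Qed.

Lemma sum_tuple_cons n (f : n.+1.-tuple bool -> K) :
  \sum_b f b = \sum_(b : bool) \sum_(bs : n.-tuple bool) f [tuple of b :: bs].
Proof.
rewrite pair_big /= (reindex (fun p : bool * n.-tuple bool => [tuple of p.1 :: p.2])) //=.
exists (fun b => (thead b, behead_tuple b)) => [[b bs] _|b _] /=.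
  by congr (_, _); apply: val_inj.
by rewrite [RHS]tuple_eta.
Qed.

(** The first comma either becomes a plus, which costs one entry and hence a factor [t], or it
    stays. *)
Lemma merge_sum_cons2 f x y ys :
  merge_sum f (x :: y :: ys) =
  t * merge_sum f ((x + y)%N :: ys) + merge_sum (fun s => f (x :: s)) (y :: ys).
Proof.
rewrite /merge_sum /= sum_tuple_cons big_bool /=; congr (_ + _).
rewrite mulr_sumr; apply: eq_bigr => b _.
by rewrite mulrA -exprS subSn // size_mzv_merge.
Qed.

Lemma merge_sumD f g ks :
  merge_sum (fun s => f s + g s) ks = merge_sum f ks + merge_sum g ks.
Proof.
case: ks => //= x xs; rewrite -big_split; apply: eq_bigr => b _.
by rewrite mulrDr.
Qed.

Lemma merge_sumZ c f ks : merge_sum (fun s => c * f s) ks = c * merge_sum f ks.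
Proof.
case: ks => //= x xs; rewrite mulr_sumr; apply: eq_bigr => b _.
by rewrite mulrCA.
Qed.

Lemma merge_sum_head_addn f c x y ys :
  (forall z s, f ((x + z)%N :: s) = c * f (z :: s)) ->
  merge_sum f ((x + y)%N :: ys) = c * merge_sum f (y :: ys).
Proof.
move=> fP; rewrite /= mulr_sumr; apply: eq_bigr => b _.
rewrite mulrCA.
(* Adding [x] to the first entry commutes with merging, so for each pattern the lengths, hence the
   powers of [t], agree. *)
have e : size (mzv_merge (x + y) ys b) = size (mzv_merge y ys b) /\
    f (mzv_merge (x + y) ys b) = c * f (mzv_merge y ys b).
  move: (val b) => {b} bs.
  elim: ys bs y => [|z zs IH] bs y /=; first by rewrite fP.
  case: bs => [|[] bs] /=; rewrite ?fP -?addnA //.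
by case: e => -> ->.
Qed.

End MergeSum.

(** * Recursion in the truncation bound *)

Section Recursion.
Variables (K : comNzRingType) (t : K) (q : nat -> K).

(* [q M] stands for [1 / (M + 1)]: the summation index is shifted by one. *)
Fixpoint qsum (ks : seq nat) (N : nat) : K :=
  match ks with
  | [::] => 1
  | k :: ks' => \sum_(M < N) q M ^+ k * qsum ks' M
  end.

(** The increment of [qsum] from [N] to [N.+1]; it is 0 for the empty sequence, whose sum is
    constantly 1. *)
Definition qtop (N : nat) (ks : seq nat) : K :=
  if ks is k :: ks' then q N ^+ k * qsum ks' N else 0.

Lemma qsumS ks N : qsum ks N.+1 = qsum ks N + qtop N ks.
Proof. by case: ks => [|k ks] /=; rewrite ?addr0 // big_ord_recr. Qed.

Definition qsum_t N := merge_sum t (qsum^~ N).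
Definition qtop_t N := merge_sum t (qtop N).

Lemma qsum_tS N ks : qsum_t N.+1 ks = qsum_t N ks + qtop_t N ks.
Proof.
rewrite /qsum_t /qtop_t -merge_sumD; case: ks => [|x xs] /=; rewrite ?addr0 //.
by apply: eq_bigr => b _; rewrite qsumS.
Qed.

(** With the largest index fixed at [N], a plus after [x] keeps the next exponent at that index with
    weight [t], while a comma sends it to smaller indices. *)
Lemma qtop_t_cons N x s :
  qtop_t N (x :: s) = q N ^+ x * (t * qtop_t N s + qsum_t N s).
Proof.
case: s => [|y ys].
  rewrite /qtop_t /qsum_t /= mulr0 add0r.
  rewrite (eq_bigr (fun=> q N ^+ x)) => [|b _].
    by rewrite big_const card_tuple expn0 /= addr0 mulr1.
  by rewrite subnn mul1r mulr1.
rewrite /qtop_t merge_sum_cons2.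
rewrite (@merge_sum_head_addn _ _ _ (q N ^+ x)) => [|z s]; last first.
  by rewrite /= exprD mulrA.
by rewrite merge_sumZ mulrDr mulrCA.
Qed.

Variable a : nat.

(* Coefficients of [z^k y^n] in the generating functions of all sums with
   [m_1 <= N], respectively [m_1 = N + 1]. *)
Definition gsum N n k : K :=
  \sum_(s <- compositions n k) qsum_t N [seq (a * x)%N | x <- s].
Definition wsum N n k : K :=
  \sum_(s <- compositions n k) qtop_t N [seq (a * x)%N | x <- s].

Lemma gsumS N n k : gsum N.+1 n k = gsum N n k + wsum N n k.
Proof. by rewrite -big_split; apply: eq_bigr => s _; rewrite qsum_tS. Qed.

Lemma wsumE N n k : wsum N n.+1 k =
  \sum_(i < k) (q N ^+ a) ^+ i.+1 *
     (t * wsum N n (k - i.+1) + gsum N n (k - i.+1)).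
Proof.
rewrite /wsum big_allpairs_dep -[X in iota 0 X]subn0 -/(index_iota 0 k) big_mkord.
apply: eq_bigr => i _.
rewrite mulr_sumr -big_split mulr_sumr; apply: eq_bigr => s _.
by rewrite map_cons qtop_t_cons exprM.
Qed.

(** The sum over the first part is geometric with ratio [q N ^+ a]: lowering a first part above 1
    gives the first summand, a first part equal to 1 the second. *)
Lemma wsumSS N n k : wsum N n.+1 k.+1 =
  q N ^+ a * wsum N n.+1 k + q N ^+ a * (t * wsum N n k + gsum N n k).
Proof.
rewrite [LHS]wsumE big_ord_recl /= expr1 subn1 /= addrC; congr (_ + _).
rewrite wsumE mulr_sumr; apply: eq_bigr => i _.
by rewrite mulrA -exprS.
Qed.

Lemma wsum0 N k : wsum N 0 k = 0.
Proof. by rewrite /wsum; case: k => [|k] /=; rewrite ?big_nil // big_seq1. Qed.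

Definition gpoly N k : {poly K} := \poly_(n < k.+1) gsum N n k.

Lemma coef_gpoly N k n : (gpoly N k)`_n = gsum N n k.
Proof.
rewrite coef_poly; case: ltnP => // kn.
by rewrite /gsum compositions_gt // big_nil.
Qed.

(** With [num_lin], the linear forms [1 + t y] and [1 + t y - y] of the generating function; ['X]
    plays the role of [y]. *)
Definition den_lin : {poly K} := 1 + t *: 'X.
Definition num_lin : {poly K} := den_lin - 'X.

(** Let [x = q N ^+ a], and let [G], [G'], [W] be the generating functions of [gsum N], [gsum N.+1],
    [wsum N]. Then [wsumSS] reads [W (1 - x z) = x z y (t W + G)], and [W = G' - G] gives [G' (1 -
    (1 + t y) x z) = G (1 - (1 + t y - y) x z)]. *)
Lemma gpolyS N k :
  gpoly N.+1 k.+1 - (q N ^+ a) *: den_lin * gpoly N.+1 k =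
  gpoly N k.+1 - (q N ^+ a) *: num_lin * gpoly N k.
Proof.
apply/polyP => n; rewrite /num_lin /den_lin -!scalerAl mulrBl !mulrDl !mul1r -!scalerAl.
rewrite !(coefD, coefN, coefZ, coefXM, coef_gpoly) !gsumS.
case: n => [|n] /=; first by rewrite !wsum0; ring.
by rewrite wsumSS; ring.
Qed.

Lemma gpoly0 N : gpoly N 0 = 1.
Proof.
apply/polyP => n; rewrite coef_gpoly coef1.
case: n => [|n]; first by rewrite /gsum /= big_seq1.
by rewrite /gsum /= big_nil.
Qed.

(* [A(s z)] restricted to [r <= N], as a polynomial in [z]. *)
Definition qprod (s : {poly K}) N : {poly {poly K}} :=
  \prod_(M < N) (1 - (q M ^+ a *: s) *: 'X).

Lemma gpoly_qprod D N :
  eqX D ((\poly_(k < D) gpoly N k) * qprod den_lin N) (qprod num_lin N).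
Proof.
elim: N => [|N IH].
  rewrite /qprod !big_ord0 mulr1 => -[|k] kD; rewrite coef_poly kD coef1 /=.
    by rewrite gpoly0.
  apply/polyP => n; rewrite coef_gpoly coef0 /gsum big_seq big1 // => s.
  rewrite mem_compositions => /and3P[_ s0 sk].
  case: s s0 sk => [|x s] //= _ _.
  rewrite /qsum_t /= big1 // => b _.
  (* No merging is empty, so all these sums over an empty range are 0. *)
  have : mzv_merge (a * x) [seq (a * x0)%N | x0 <- s] b != [::].
    move: (val b) => {b} bs.
    by elim: (map _ _) bs (a * x)%N => [|y ys IHs] [|[] bs] z /=; rewrite ?IHs.
  by case: mzv_merge => //= *; rewrite big_ord0 mulr0.
rewrite /qprod !big_ord_recr /= -/(qprod _ _) -/(qprod _ _).
set P := \poly_(k < D) gpoly N.+1 k; set P0 := \poly_(k < D) gpoly N k in IH.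
have step : eqX D (P * (1 - (q N ^+ a *: den_lin) *: 'X)) (P0 * (1 - (q N ^+ a *: num_lin) *: 'X)).
  move=> k kD; rewrite !mulrBr !mulr1 -!scalerAr !coefB !coefZ !coefMX !coef_poly kD.
  case: k kD => [|k] kD /=; first by rewrite !mulr0 !gpoly0.
  by rewrite ltnW // gpolyS.
have -> : P * (qprod den_lin N * (1 - (q N ^+ a *: den_lin) *: 'X)) =
  (P * (1 - (q N ^+ a *: den_lin) *: 'X)) * qprod den_lin N by ring.
apply: (eqX_trans (eqXM step (fun i _ => erefl))).
have -> : P0 * (1 - (q N ^+ a *: num_lin) *: 'X) * qprod den_lin N =
  (P0 * qprod den_lin N) * (1 - (q N ^+ a *: num_lin) *: 'X) by ring.
exact: eqXM.
Qed.

End Recursion.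

(** * Euler's product for the sine *)

(** Its coefficients are the elementary symmetric functions of the first [N] values of [y]. *)
Definition epoly (A : comNzRingType) (y : nat -> A) (N : nat) : {poly A} :=
  \prod_(r < N) (1 + y r *: 'X).

Lemma epoly0 (A : comNzRingType) (y : nat -> A) : epoly y 0 = 1.
Proof. by rewrite /epoly big_ord0. Qed.

Lemma epolyS (A : comNzRingType) (y : nat -> A) N :
  epoly y N.+1 = epoly y N * (1 + y N *: 'X).
Proof. by rewrite /epoly big_ord_recr. Qed.

Lemma coef_epolyS (A : comNzRingType) (y : nat -> A) N l :
  (epoly y N.+1)`_l =
  (epoly y N)`_l + y N * (if l is l'.+1 then (epoly y N)`_l' else 0).
Proof.
by rewrite epolyS mulrDr mulr1 -scalerAr coefD coefZ coefMX; case: l.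
Qed.

Lemma coef_epolyZ (A : comNzRingType) (y : nat -> A) c N l :
  (epoly (fun r => c * y r) N)`_l = c ^+ l * (epoly y N)`_l.
Proof.
elim: N l => [|N IH] l.
  by rewrite !epoly0 coef1; case: l => [|l]; rewrite ?mulr1 ?mulr0.
rewrite !coef_epolyS !IH; case: l => [|l]; first by rewrite !mulr0 !addr0.
by rewrite IH exprS; ring.
Qed.

Lemma coef_epoly_ge0 (A : numDomainType) (y : nat -> A) N l :
  (forall r, (r < N)%N -> 0 <= y r) -> 0 <= (epoly y N)`_l.
Proof.
elim: N l => [|N IH] l y0; first by rewrite epoly0 coef1 ler0n.
have y0' r : (r < N)%N -> 0 <= y r by move=> rN; apply: y0; apply: ltnW.
rewrite coef_epolyS addr_ge0 ?IH // mulr_ge0 ?y0 //.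
by case: l => // l; apply: IH.
Qed.

Lemma le_coef_epoly (A : numDomainType) (y z : nat -> A) N l :
  (forall r, (r < N)%N -> 0 <= y r <= z r) ->
  (epoly y N)`_l <= (epoly z N)`_l.
Proof.
elim: N l => [|N IH] l yz; first by rewrite !epoly0.
have yz' r : (r < N)%N -> 0 <= y r <= z r by move=> rN; apply: yz; apply: ltnW.
rewrite !coef_epolyS lerD ?IH //; have /andP[y0 yzN] := yz N (ltnSn N).
case: l => [|l]; first by rewrite !mulr0.
rewrite ler_pM ?IH //; apply: coef_epoly_ge0 => r rN.
by have /andP[] := yz' r rN.
Qed.

(* Coefficientwise, [1 + (1 + y) X <= (1 + y X) (1 + X)]. *)
Lemma coef_epoly_add1 (A : numDomainType) (y : nat -> A) N l :
  (forall r, (r < N)%N -> 0 <= y r) ->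
  (epoly (fun r => 1 + y r) N)`_l <=
  \sum_(j < l.+1) (epoly y N)`_j * 'C(N, l - j)%:R.
Proof.
move=> y0.
suff h : forall l, (epoly (fun r => 1 + y r) N)`_l <=
    (epoly y N * (1 + 'X) ^+ N)`_l.
  apply: (le_trans (h l)); rewrite coefM; apply: ler_sum => j _.
  rewrite [(1 + 'X) ^+ N]exprDn (eq_bigr (fun i : 'I_N.+1 => 'C(N, i)%:R *: 'X^i)); last first.
    by move=> i _; rewrite expr1n mul1r scaler_nat.
  rewrite -(poly_def N.+1 (fun i => 'C(N, i)%:R)) coef_poly.
  by case: ltnP => // h'; rewrite bin_small.
elim: N y0 {l} => [|N IH] y0 l; first by rewrite !epoly0 mulr1.
have y0' r : (r < N)%N -> 0 <= y r by move=> rN; apply: y0; apply: ltnW.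
rewrite coef_epolyS epolyS exprSr.
set P := epoly y N * _ in IH.
have -> : epoly y N * (1 + y N *: 'X) * ((1 + 'X) ^+ N * (1 + 'X)) =
  P + (1 + y N) *: (P * 'X) + y N *: (P * 'X * 'X).
  by rewrite /P -!mul_polyC polyCD; ring.
have P0 j : 0 <= P`_j.
  rewrite coefM sumr_ge0 // => i _; rewrite mulr_ge0 ?coef_epoly_ge0 //.
  rewrite exprDn coef_sum sumr_ge0 // => r _.
  by rewrite expr1n mul1r coefMn coefXn mulrn_wge0 ?ler0n.
have yN := y0 N (ltnSn N).
rewrite !coefD !coefZ !coefMX.
case: l => [|l] /=; first by rewrite !mulr0 !addr0; apply: IH.
rewrite -[leLHS]addr0 lerD ?lerD ?IH ?IH // ?ler_wpM2l ?IH ?addr_ge0 //.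
by rewrite mulr_ge0 //; case: l.
Qed.

(** * Elementary symmetric functions of squared cotangents *)

Section Cotangent.
Variable R : realType.

Definition cis (x : R) : R[i] := (cos x +i* sin x)%C.

Lemma cisX x n : cis x ^+ n = cis (n%:R * x).
Proof.
elim: n => [|n IH]; first by rewrite expr0 mul0r /cis cos0 sin0.
rewrite exprS IH -natr1 mulrDl mul1r addrC /cis cosD sinD.
by apply/eqP; rewrite eq_complex /= [cos x * sin _ + _]addrC !eqxx.
Qed.

Lemma sin_natpi n : sin (n%:R * pi) = 0 :> R.
Proof.
elim: n => [|n IH]; first by rewrite mul0r sin0.
by rewrite -natr1 mulrDl mul1r sinDpi IH oppr0.
Qed.

(** The even powers of [u] cancel. At [u = i tan x] the remaining sum is a polynomial in
    [- tan^2 x]. *)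
Lemma oddbin_sum (A : comNzRingType) (u : A) N :
  (1 + u) ^+ (2 * N).+1 - (1 - u) ^+ (2 * N).+1 =
  u * 2 * \sum_(j < N.+1) 'C((2 * N).+1, (2 * j).+1)%:R * (u ^+ 2) ^+ j.
Proof.
rewrite !exprDn -sumrB.
have e : (2 * N).+2 = (2 * N.+1)%N by lia.
rewrite [X in X = _](_ : _ = \sum_(i < (2 * N).+2)
  (u ^+ i - (- u) ^+ i) *+ 'C((2 * N).+1, i)); last first.
  by apply: eq_bigr => i _; rewrite !expr1n !mul1r mulrnBl.
rewrite e (@sum_ord_double _ N.+1
  (fun i => (u ^+ i - (- u) ^+ i) *+ 'C((2 * N).+1, i))) mulr_sumr.
apply: eq_bigr => j _; rewrite !(exprS _ (2 * j)) !exprM sqrrN subrr mul0rn add0r.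
rewrite -[_ *+ 'C(_, _)]mulr_natl; ring.
Qed.

Definition theta (N r : nat) : R := r.+1%:R * pi / (2 * N).+1%:R.
Definition cot2 (N r : nat) : R := (tan (theta N r) ^+ 2)^-1.

Lemma theta_pihalf N r : (r < N)%N -> 0 < theta N r < pi / 2.
Proof.
move=> rN; apply/andP; split.
  by rewrite divr_gt0 ?mulr_gt0 ?pi_gt0 ?ltr0n.
rewrite /theta ltr_pdivrMr ?ltr0n // mulrAC ltr_pdivlMr ?ltr0n //.
rewrite -mulrA [pi * 2]mulrC mulrA [pi * _]mulrC ltr_pM2r ?pi_gt0 // -natrM.
by rewrite ltr_nat; lia.
Qed.

Lemma tan_theta_gt0 N r : (r < N)%N -> 0 < tan (theta N r).
Proof.
move=> rN; have := theta_pihalf rN => /andP[x0 xpi].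
by rewrite divr_gt0 // ?sin_gt0_pihalf ?cos_gt0_pihalf //; lra.
Qed.

(** [1 + i tan x] and [1 - i tan x] are [e^(ix)] and [e^(-ix)] divided by [cos x]. At
    [x = theta N r] the angle [(2N+1) x] is a multiple of [pi], so their powers of exponent [2N+1]
    coincide and the difference in [oddbin_sum] is 0. *)
Lemma tan2_root N r : (r < N)%N ->
  \sum_(j < N.+1) 'C((2 * N).+1, (2 * j).+1)%:R *
     (- tan (theta N r) ^+ 2) ^+ j = 0 :> R.
Proof.
move=> rN; set n := (2 * N).+1; set x := theta N r.
have n0 : n%:R != 0 :> R by rewrite pnatr_eq0.
have /andP[x0 xpi] : 0 < x < pi / 2 := theta_pihalf rN.
have c0 : 0 < cos x by apply: cos_gt0_pihalf; lra.
have s0 : 0 < sin x by apply: sin_gt0_pihalf; lra.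
pose u : R[i] := (0 +i* tan x)%C.
have u2 : u ^+ 2 = (- tan x ^+ 2)%:C%C.
  by apply/eqP; rewrite eq_complex /=; apply/andP; split; apply/eqP; ring.
have e1 : 1 + u = ((cos x)^-1)%:C%C * cis x.
  by apply/eqP; rewrite eq_complex /= /tan; apply/andP; split; apply/eqP;
    field; rewrite gt_eqF.
have e2 : 1 - u = ((cos x)^-1)%:C%C * cis (- x).
  by apply/eqP; rewrite eq_complex /= cosN sinN /tan; apply/andP; split;
    apply/eqP; field; rewrite gt_eqF.
have h : (1 + u) ^+ n = (1 - u) ^+ n.
  rewrite e1 e2 !exprMn !cisX mulrN; congr (_ * _).
  have -> : n%:R * x = r.+1%:R * pi by rewrite /x /theta -/n; field.
  by rewrite /cis cosN sinN sin_natpi oppr0.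
have := oddbin_sum u N; rewrite -/n h subrr => /esym/eqP.
have u0 : u != 0.
  by rewrite eq_complex /= eqxx /= /tan mulf_neq0 ?invr_eq0 ?gt_eqF.
rewrite !mulf_eq0 (negbTE u0) pnatr_eq0 /= => /eqP hs.
apply: (@complexI R); rewrite rmorph0 -hs rmorph_sum; apply: eq_bigr => j _.
by rewrite rmorphM rmorph_nat rmorphXn /= u2.
Qed.

(* Both sides vanish at the [N] points [- tan^2 (theta N r)], as
   [Im ((1 + i tan x)^(2N+1))] is a multiple of [sin ((2N+1) x)]. *)
Lemma epoly_cot2 N :
  (2 * N).+1%:R *: epoly (cot2 N) N =
  \poly_(j < N.+1) 'C((2 * N).+1, (2 * j).+1)%:R.
Proof.
set Q := RHS.
have sQ : size Q = N.+1.
  by apply: size_poly_eq; rewrite binn oner_neq0.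
pose rs := [seq - tan (theta N r) ^+ 2 | r <- iota 0 N].
have QE : Q = \prod_(z <- rs) ('X - z%:P).
  have lQ : lead_coef Q = 1 by rewrite lead_coefE sQ coef_poly ltnSn binn.
  rewrite -[RHS]scale1r -lQ; apply: all_roots_prod_XsubC.
  - by rewrite size_map size_iota.
  - apply/allP => _ /mapP[r + ->]; rewrite mem_iota add0n /= => rN.
    apply/rootP; rewrite horner_poly; exact: tan2_root.
  rewrite uniq_rootsE map_inj_in_uniq ?iota_uniq // => r s.
  rewrite !mem_iota !add0n /= => rN sN /eqP.
  rewrite eqr_opp eqrXn2 // ?ltW ?tan_theta_gt0 // => /eqP.
  have /andP[x0 xp] := theta_pihalf rN; have /andP[y0 yp] := theta_pihalf sN.
  move=> h; have /eqP : theta N r = theta N s.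
    by apply: tan_inj => //; rewrite in_itv /=; apply/andP; split; lra.
  rewrite /theta -subr_eq0 -!mulrA -mulrBl !mulf_eq0 invr_eq0 pnatr_eq0 orbF.
  by rewrite [pi == 0]gt_eqF ?pi_gt0 // orbF subr_eq0 eqr_nat eqSS => /eqP.
rewrite /rs big_map -[X in iota 0 X]subn0 -/(index_iota 0 N) big_mkord in QE.
(* The constant coefficient gives the product of all [tan^2], the factor to extract in order to turn
   each [X + tan^2] into [1 + cot2 N r *: 'X]. *)
have n0 : (2 * N).+1%:R = \prod_(r < N) tan (theta N r) ^+ 2.
  have : Q`_0 = (2 * N).+1%:R by rewrite coef_poly /= bin1.
  rewrite -horner_coef0 QE horner_prod => <-; apply: eq_bigr => r _.
  by rewrite !hornerE opprK.
rewrite n0 /epoly -scaler_prod QE; apply: eq_bigr => r _.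
rewrite scalerDr scalerA /cot2 divff ?scale1r; last first.
  by rewrite expf_neq0 // gt_eqF // tan_theta_gt0.
by rewrite polyCN opprK addrC -mul_polyC mulr1.
Qed.

Lemma coef_epoly_cot2 N l :
  (epoly (cot2 N) N)`_l = 'C((2 * N).+1, (2 * l).+1)%:R / (2 * N).+1%:R.
Proof.
apply: (@mulfI R (2 * N).+1%:R); first by rewrite pnatr_eq0.
rewrite -coefZ epoly_cot2 coef_poly mulrC divfK ?pnatr_eq0 //.
by case: ltnP => // Nl; rewrite bin_small //; lia.
Qed.

Lemma sin_le (x : R) : 0 < x -> sin x <= x.
Proof.
move=> x0.
have [|c _] := @MVT R sin cos 0 x x0 (fun y _ => is_derive_sin y).
  by apply: continuous_subspaceT; apply: continuous_sin.
rewrite sin0 !subr0 => ->.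
by have := cos_le1 c; nra.
Qed.

Lemma le_tan (x : R) : 0 < x < pi / 2 -> x <= tan x.
Proof.
move=> /andP[x0 xpi].
have c0 y : 0 <= y <= x -> 0 < cos y by move=> ?; apply: cos_gt0_pihalf; lra.
have dtan y : y \in `]0, x[%R -> is_derive y 1 tan ((cos y) ^- 2).
  rewrite in_itv /= => yx; apply: is_derive_tan.
  by rewrite gt_eqF // c0 //; lra.
have [|c] := MVT x0 dtan.
  apply: derivable_within_continuous => y; rewrite in_itv /= => yx.
  by apply: derivable_tan; rewrite gt_eqF // c0.
rewrite in_itv /= tan0 !subr0 => cx ->.
have cc0 : 0 < cos c by apply: c0; lra.
have : 1 <= (cos c) ^- 2.
  by rewrite invf_ge1 ?exprn_gt0 // expr_le1 ?cos_le1 // ltW.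
by move: (_ ^- 2) => z; nra.
Qed.

(** Inverse squares of [sin x <= x <= tan x], as [1 + cot^2 x = 1 / sin^2 x]. *)
Lemma theta_bounds N r : (r < N)%N ->
  0 <= cot2 N r <= (theta N r ^+ 2)^-1 /\
  0 <= (theta N r ^+ 2)^-1 <= 1 + cot2 N r.
Proof.
move=> rN; have xpi := theta_pihalf rN; have /andP[x0 xp] := xpi.
have t0 := tan_theta_gt0 rN.
have s0 : 0 < sin (theta N r) by apply: sin_gt0_pihalf.
have c0 : 0 < cos (theta N r) by apply: cos_gt0_pihalf; lra.
split; apply/andP; split.
- by rewrite invr_ge0 sqr_ge0.
- by rewrite lef_pV2 ?posrE ?exprn_gt0 // ler_sqr ?nnegrE ?(ltW x0) ?(ltW t0) // le_tan.
- by rewrite invr_ge0 sqr_ge0.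
have -> : 1 + cot2 N r = (sin (theta N r) ^+ 2)^-1.
  rewrite -[RHS]mul1r.
  transitivity ((cos (theta N r) ^+ 2 + sin (theta N r) ^+ 2) / sin (theta N r) ^+ 2).
    by rewrite /cot2 /tan; field; rewrite !gt_eqF.
  by rewrite cos2Dsin2.
by rewrite lef_pV2 ?posrE ?exprn_gt0 // ler_sqr ?nnegrE ?(ltW x0) ?(ltW s0) // sin_le.
Qed.

End Cotangent.

(** * Limits of the elementary symmetric functions *)

Lemma bin_le_exp n q : ('C(n, q) <= n ^ q)%N.
Proof.
apply: (@leq_trans ('C(n, q) * q`!)%N); first by rewrite leq_pmulr // fact_gt0.
rewrite bin_ffact ffact_prod -[X in (_ <= n ^ X)%N]card_ord -prod_nat_const.
by apply: leq_prod => i _; apply: leq_subr.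
Qed.

Section EulerSine.
Local Open Scope classical_set_scope.
Variable R : realType.

Lemma cvg_inv_odd : ((2 * N).+1%:R^-1 : R) @[N --> \oo] --> (0 : R).
Proof.
apply: (@squeeze_cvgr _ _ _ _ (fun=> 0) (@harmonic R)).
- near=> N; rewrite invr_ge0 ler0n /= /harmonic /=.
  by rewrite lef_pV2 ?posrE ?ltr0n // ler_nat ltnS leq_pmull.
- exact: cvg_cst.
- exact: cvg_harmonic.
Unshelve. all: by end_near.
Qed.

Lemma cvg_bin_odd q :
  ('C((2 * N).+1, q)%:R / (2 * N).+1%:R ^+ q : R) @[N --> \oo] --> (q`!%:R^-1 : R).
Proof.
(* With [n = 2N+1], the falling factorial divided by [n^q] is the product of the [1 - i / n],
   [i < q]. *)
have h : (q`!%:R^-1 * \prod_(i < q) (1 - i%:R * (2 * N).+1%:R^-1) : R) @[N --> \oo]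
    --> (q`!%:R^-1 : R).
  rewrite -[X in _ --> X]mulr1; apply: cvgMr.
  rewrite [X in _ --> X](_ : 1 = \prod_(i < q) (1 : R)); last by rewrite big1.
  apply: (@cvg_big R^o 'I_q *%R 1); first exact: mul_continuous.
  move=> i _; rewrite -[X in _ --> X]subr0; apply: cvgB; first exact: cvg_cst.
  rewrite -(mulr0 (i%:R : R)); apply: cvgMr; exact: cvg_inv_odd.
apply: cvg_trans h; apply: near_eq_cvg; near=> N.
have qN : (q <= N)%N by near: N; exists q.
have f0 : q`!%:R != 0 :> R by rewrite pnatr_eq0 -lt0n fact_gt0.
have n0 : (2 * N).+1%:R != 0 :> R by rewrite pnatr_eq0.
have -> : 'C((2 * N).+1, q)%:R = q`!%:R^-1 * \prod_(i < q) ((2 * N).+1 - i)%:R :> R.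
  by rewrite -natr_prod -ffact_prod -bin_ffact natrM mulrC mulfK.
rewrite -mulrA -[X in _ ^+ X]card_ord -prodr_const -prodf_div; congr (_ * _).
apply: eq_bigr => i _; rewrite natrB; last by have := ltn_ord i; lia.
by field.
Unshelve. all: by end_near.
Qed.

(** Squeeze between the elementary symmetric functions of [cot^2] and of [1 + cot^2] at the
    [theta N r], scaled by [(pi / n)^(2l)] with [n = 2N+1]. Up to the factor [pi^(2l)], the shift by
    1 costs at most [l / n]. *)
Lemma cvg_epoly_zeta2 l :
  ((epoly (fun r : nat => (r.+1%:R ^+ 2)^-1 : R) N)`_l) @[N --> \oo]
    --> (pi ^+ (2 * l) / (2 * l).+1`!%:R : R).
Proof.
pose v N : R := 'C((2 * N).+1, (2 * l).+1)%:R / (2 * N).+1%:R ^+ (2 * l).+1.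
apply: (@squeeze_cvgr _ _ _ _ (fun N => pi ^+ (2 * l) * v N)
  (fun N => pi ^+ (2 * l) * (v N + l%:R * (2 * N).+1%:R^-1))); last 2 first.
- by apply: cvgMr; exact: cvg_bin_odd.
- apply: cvgMr; rewrite -[X in _ --> X]addr0; apply: cvgD; first exact: cvg_bin_odd.
  by rewrite -(mulr0 (l%:R : R)); apply: cvgMr; exact: cvg_inv_odd.
near=> N.
set n : R := (2 * N).+1%:R.
have n0 : 0 < n by rewrite ltr0n.
have p0 := pi_gt0 R.
have -> : (epoly (fun r : nat => (r.+1%:R ^+ 2)^-1 : R) N)`_l =
    ((pi / n) ^+ 2) ^+ l * (epoly (fun r => (theta R N r ^+ 2)^-1) N)`_l.
  rewrite -coef_epolyZ; congr (nth 0 (polyseq _) l).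
  apply: eq_bigr => r _.
  congr (_ + _ *: _); rewrite /theta -/n.
  have : r.+1%:R != 0 :> R by rewrite pnatr_eq0.
  move: p0 n0 => /lt0r_neq0 + /lt0r_neq0; move: (r.+1%:R) pi n => x p y.
  by move=> *; field; apply/and3P.
have cE : ((pi / n) ^+ 2) ^+ l = pi ^+ (2 * l) / n ^+ (2 * l).
  by rewrite -exprM expr_div_n.
rewrite cE -!mulrA !ler_pM2l ?exprn_gt0 //; apply/andP; split.
  apply: (@le_trans _ _ ((n ^+ (2 * l))^-1 * (epoly (cot2 R N) N)`_l)).
    rewrite coef_epoly_cot2 /v -/n le_eqVlt; apply/orP; left; apply/eqP.
    by rewrite exprS; field; rewrite ?expf_neq0 ?gt_eqF.
  rewrite ler_pM2l ?invr_gt0 ?exprn_gt0 //; apply: le_coef_epoly => r rN.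
  by case: (theta_bounds R rN).
apply: (@le_trans _ _ ((n ^+ (2 * l))^-1 * (epoly (fun r => 1 + cot2 R N r) N)`_l)).
  rewrite ler_pM2l ?invr_gt0 ?exprn_gt0 //; apply: le_coef_epoly => r rN.
  by case: (theta_bounds R rN).
rewrite mulrC ler_pdivrMr ?exprn_gt0 //.
have c0 r : (r < N)%N -> 0 <= cot2 R N r.
  by move=> rN; have [/andP[]] := theta_bounds R rN.
apply: (le_trans (coef_epoly_add1 l c0)).
rewrite big_ord_recr /= subnn bin0 mulr1 addrC mulrDl; apply: lerD.
  rewrite coef_epoly_cot2 /v -/n le_eqVlt; apply/orP; left; apply/eqP.
  rewrite exprS; field; rewrite ?expf_neq0 ?gt_eqF //.
(* For [j < l] the binomials are at most [n^(2j+1)] and [n^(l-j)]; with the denominators [n] and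
   [n^(2l)], each of these [l] terms is at most [1 / n]. *)
rewrite -mulrA mulr_natl -[X in _ *+ X]card_ord -sumr_const; apply: ler_sum => j _.
rewrite coef_epoly_cot2 -/n.
have jl := ltn_ord j.
rewrite mulrAC mulrC ler_pM2l ?invr_gt0 // -natrM -natrX ler_nat.
apply: (@leq_trans ((2 * N).+1 ^ (2 * j).+1 * (2 * N).+1 ^ (l - j))).
  apply: leq_mul; first exact: bin_le_exp.
  by apply: (leq_trans (bin_le_exp _ _)); rewrite leq_exp2r; lia.
by rewrite -expnD leq_pexp2l //; lia.
Unshelve. all: by end_near.
Qed.

End EulerSine.

(** * Limits *)

Section ComplexLimits.
Local Open Scope classical_set_scope.
Variable R : realType.
Implicit Types (u v : nat -> R[i]) (l m : R[i]).

(** Componentwise convergence, which reduces limits in [R[i]] to real ones. *)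
Definition ccvg u l :=
  (complex.Re (u N) @[N --> \oo] --> complex.Re l) /\
  (complex.Im (u N) @[N --> \oo] --> complex.Im l).

Lemma ccvg_cst l : ccvg (fun=> l) l.
Proof. by split; apply: cvg_cst. Qed.

Lemma ccvg_ext u v l : u =1 v -> ccvg u l -> ccvg v l.
Proof. by move=> /funext ->. Qed.

Lemma ccvgD u v l m : ccvg u l -> ccvg v m -> ccvg (fun N => u N + v N) (l + m).
Proof.
move=> [ul1 ul2] [vm1 vm2]; split.
  rewrite (_ : (fun N => _) = (fun N => complex.Re (u N) + complex.Re (v N))).
    rewrite (_ : complex.Re (l + m) = complex.Re l + complex.Re m).
      exact: cvgD.
    by case: l {ul1 ul2} => ? ?; case: m {vm1 vm2}.
  by apply/funext => N; case: (u N) => ? ?; case: (v N).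
rewrite (_ : (fun N => _) = (fun N => complex.Im (u N) + complex.Im (v N))).
  rewrite (_ : complex.Im (l + m) = complex.Im l + complex.Im m).
    exact: cvgD.
  by case: l {ul1 ul2} => ? ?; case: m {vm1 vm2}.
by apply/funext => N; case: (u N) => ? ?; case: (v N).
Qed.

Lemma ccvgM u v l m : ccvg u l -> ccvg v m -> ccvg (fun N => u N * v N) (l * m).
Proof.
have mulE (x y : R[i]) : x * y =
  ((complex.Re x * complex.Re y - complex.Im x * complex.Im y) +i*
   (complex.Re x * complex.Im y + complex.Im x * complex.Re y))%C.
  by case: x => ? ?; case: y.
move=> [ul1 ul2] [vm1 vm2]; split; under eq_fun do rewrite mulE; rewrite mulE /=.
  by apply: cvgB; apply: cvgM.
by apply: cvgD; apply: cvgM.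
Qed.

Lemma ccvg_sum (I : Type) (r : seq I) (P : pred I) (u : I -> nat -> R[i]) (l : I -> R[i]) :
  (forall i, P i -> ccvg (u i) (l i)) ->
  ccvg (fun N => \sum_(i <- r | P i) u i N) (\sum_(i <- r | P i) l i).
Proof.
move=> ul; elim: r => [|i r IH].
  by apply: (ccvg_ext _ (ccvg_cst _)) => N; rewrite !big_nil.
rewrite big_cons; case: ifP => Pi.
  by apply: (ccvg_ext _ (ccvgD (ul i Pi) IH)) => N; rewrite big_cons Pi.
by apply: (ccvg_ext _ IH) => N; rewrite big_cons Pi.
Qed.

Lemma ccvg_prod (I : Type) (r : seq I) (u : I -> nat -> R[i]) (l : I -> R[i]) :
  (forall i, ccvg (u i) (l i)) ->
  ccvg (fun N => \prod_(i <- r) u i N) (\prod_(i <- r) l i).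
Proof.
move=> ul; elim: r => [|i r IH].
  by apply: (ccvg_ext _ (ccvg_cst _)) => N; rewrite !big_nil.
rewrite big_cons.
by apply: (ccvg_ext _ (ccvgM (ul i) IH)) => N; rewrite big_cons.
Qed.

Lemma ccvg_real (x : nat -> R) (y : R) :
  x @ \oo --> y -> ccvg (fun N => (x N)%:C%C) y%:C%C.
Proof. by move=> xy; split => //=; apply: cvg_cst. Qed.

Lemma ccvg_unique u l m : ccvg u l -> ccvg u m -> l = m.
Proof.
move=> [l1 l2] [m1 m2]; apply/eqP; rewrite eq_complex.
by rewrite (cvg_unique _ l1 m1) // (cvg_unique _ l2 m2) // !eqxx.
Qed.

Definition pccvg (p : nat -> {poly R[i]}) (q : {poly R[i]}) :=
  forall n, ccvg (fun N => (p N)`_n) q`_n.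

Lemma pccvg_ext p p' q : p =1 p' -> pccvg p q -> pccvg p' q.
Proof. by move=> /funext ->. Qed.

Lemma pccvg_cst q : pccvg (fun=> q) q.
Proof. by move=> n; apply: ccvg_cst. Qed.

Lemma pccvg_polyC u l : ccvg u l -> pccvg (fun N => (u N)%:P) l%:P.
Proof.
move=> ul n; rewrite coefC; case: eqP => [->|n0].
  by apply: (ccvg_ext _ ul) => N; rewrite coefC.
by apply: (ccvg_ext _ (ccvg_cst _)) => N; rewrite coefC; case: eqP.
Qed.

Lemma pccvgM p p' q q' :
  pccvg p q -> pccvg p' q' -> pccvg (fun N => p N * p' N) (q * q').
Proof.
move=> pq pq' n; rewrite coefM.
apply: (@ccvg_ext (fun N => \sum_(j < n.+1) (p N)`_j * (p' N)`_(n - j))).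
  by move=> N; rewrite coefM.
by apply: ccvg_sum => j _; apply: ccvgM.
Qed.

Lemma pccvg_sum (I : Type) (r : seq I) (p : I -> nat -> {poly R[i]}) (q : I -> {poly R[i]}) :
  (forall i, pccvg (p i) (q i)) ->
  pccvg (fun N => \sum_(i <- r) p i N) (\sum_(i <- r) q i).
Proof.
move=> pq n; rewrite coef_sum.
apply: (@ccvg_ext (fun N => \sum_(i <- r) (p i N)`_n)).
  by move=> N; rewrite coef_sum.
by apply: ccvg_sum => i _; apply: pq.
Qed.

Lemma pccvg_unique p q q' : pccvg p q -> pccvg p q' -> q = q'.
Proof. by move=> h h'; apply/polyP => n; apply: ccvg_unique (h n) (h' n). Qed.

End ComplexLimits.

(** * Convergence of the truncated multiple zeta values *)

Section MzvLimits.
Local Open Scope classical_set_scope.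
Variable R : realType.

Definition qinv (K : fieldType) (M : nat) : K := M.+1%:R^-1.

Lemma mzv_truncE ks N : mzv_trunc ks N = qsum (qinv R) ks N.
Proof.
elim: ks N => //= k ks IH N; rewrite big_add1 big_mkord.
by apply: eq_bigr => i _; rewrite IH exprVn.
Qed.

Lemma qsum_complex ks N : qsum (qinv R[i]) ks N = (mzv_trunc ks N : R)%:C%C.
Proof.
rewrite mzv_truncE; elim: ks N => [|k ks IH] N /=; first by rewrite rmorph1.
rewrite rmorph_sum; apply: eq_bigr => i _.
by rewrite IH rmorphM rmorphXn /qinv fmorphV rmorph_nat.
Qed.

Lemma sum_inv_sqr_le N : \sum_(M < N) qinv R M ^+ 2 <= 2.
Proof.
(* The induction needs this stronger bound; with [x = n+1], its step has slack [1 / (x (x+1)^2)]. *)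
have h n : \sum_(M < n.+1) qinv R M ^+ 2 <= 2 - qinv R n.
  elim: n => [|n IH]; first by rewrite big_ord1 /qinv invr1 expr1n; lra.
  rewrite big_ord_recr /=; apply: (le_trans (lerD IH (lexx _))).
  rewrite /qinv -subr_ge0.
  have n1 : 0 < n.+1%:R :> R by rewrite ltr0n.
  have -> : n.+2%:R = n.+1%:R + 1 :> R by rewrite -natr1.
  move: (n.+1%:R : R) n1 => x x0.
  have -> : 2 - (x + 1)^-1 - (2 - x^-1 + (x + 1)^-1 ^+ 2) =
    (x * (x + 1) ^+ 2)^-1 by field; lra.
  by rewrite invr_ge0 mulr_ge0 ?sqr_ge0 // ltW.
case: N => [|N]; first by rewrite big_ord0.
by apply: (le_trans (h N)); rewrite gerBl invr_ge0 ler0n.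
Qed.

Lemma qinv_ge0 M : 0 <= qinv R M. Proof. by rewrite invr_ge0 ler0n. Qed.

Lemma qsum_ge0 ks N : 0 <= qsum (qinv R) ks N.
Proof.
elim: ks N => //= k ks IH N; apply: sumr_ge0 => i _.
by rewrite mulr_ge0 // exprn_ge0 // qinv_ge0.
Qed.

Lemma qsum_le ks N : all (leq 2) ks -> qsum (qinv R) ks N <= 2 ^+ size ks.
Proof.
elim: ks N => //= k ks IH N /andP[k2 ks2].
rewrite exprS; apply: (@le_trans _ _ (\sum_(M < N) qinv R M ^+ 2 * 2 ^+ size ks)).
  apply: ler_sum => M _; apply: ler_pM; rewrite ?exprn_ge0 ?qinv_ge0 ?qsum_ge0 ?IH //.
  apply: ler_wiXn2l => //; first exact: qinv_ge0.
  by rewrite invf_le1 ?ltr0n // ler1n.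
by rewrite -mulr_suml ler_pM2r ?exprn_gt0 ?ltr0n // sum_inv_sqr_le.
Qed.

(** The truncations increase with [N] and, all exponents being at least 2, are bounded by [qsum_le];
    so the [limn] in [mzv] is a genuine limit. *)
Lemma cvg_mzv_trunc ks : all (leq 2) ks ->
  (mzv_trunc ks N : R) @[N --> \oo] --> mzv ks.
Proof.
move=> ks2.
have : cvgn (fun N => mzv_trunc ks N : R).
  apply: nondecreasing_is_cvgn.
    apply/nondecreasing_seqP => N; rewrite !mzv_truncE qsumS lerDl.
    case: ks {ks2} => //= k ks.
    by rewrite mulr_ge0 ?qsum_ge0 // exprn_ge0 // qinv_ge0.
  by exists (2 ^+ size ks) => _ [N _ <-]; rewrite mzv_truncE qsum_le.
exact.
Qed.

Lemma all_mzv_merge x xs b : all (leq 2) (x :: xs) -> all (leq 2) (mzv_merge x xs b).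
Proof.
elim: xs x b => [|y ys IH] x [|[] b] //= /and3P[x2 y2 ys2]; rewrite ?x2 //=.
  by apply: IH; rewrite /= ys2 andbT; apply: (leq_trans x2); apply: leq_addr.
by apply: IH; rewrite /= y2.
Qed.

Lemma ccvg_qsum_t (t : R[i]) ks : all (leq 2) ks ->
  ccvg (fun N => qsum_t t (qinv R[i]) N ks) (mzv_t t ks).
Proof.
case: ks => [|x xs] ks2; first exact: ccvg_cst.
apply: ccvg_sum => b _; apply: ccvgM; first exact: ccvg_cst.
apply: (@ccvg_ext _ (fun N => (mzv_trunc (mzv_merge x xs b) N : R)%:C%C)).
  by move=> N; rewrite qsum_complex.
by apply: ccvg_real; apply: cvg_mzv_trunc; apply: all_mzv_merge.
Qed.

End MzvLimits.

(** * Products of twisted power series *)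

Section Convolution.
Variables (K : comNzRingType) (m : nat) (w : K).

(* Coefficient of [X^D] in the product over [p < m] of [sum_i f i (w^p X)^i]. *)
Definition twist_coef (f : nat -> K) (D : nat) : K :=
  \sum_(c : {ffun 'I_m -> 'I_D.+1} | (\sum_(p < m) (c p : nat))%N == D)
     \prod_(p < m) (f (c p) * (w ^+ p) ^+ c p).

Definition twist_poly (f : nat -> K) (E : nat) : {poly K} :=
  \prod_(p < m) \poly_(i < E) (f i * (w ^+ p) ^+ i).

Lemma coef_twist_poly f E D : (D < E)%N -> (twist_poly f E)`_D = twist_coef f D.
Proof.
move=> DE; rewrite coef_prod_ffun; apply: eq_bigr => c _; apply: eq_bigr => p _.
by rewrite coef_poly (leq_trans (ltn_ord (c p)) DE).
Qed.

(** The hypothesis says that [f] and [g] are the coefficients of inverse power series. Substituting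
    [w^p X] keeps them inverse, hence so are the products over [p]. *)
Lemma twist_coef_inv (f g : nat -> K) D :
  (forall n, \sum_(i < n.+1) f i * g (n - i)%N = (n == 0)%:R) ->
  \sum_(i < D.+1) twist_coef f i * twist_coef g (D - i) = (D == 0)%:R.
Proof.
move=> fg.
have : eqX D.+1 (twist_poly f D.+1 * twist_poly g D.+1) 1.
  rewrite -big_split /=.
  rewrite [X in eqX _ _ X](_ : 1 = \prod_(p < m) 1); last by rewrite big1.
  apply: eqX_prod => p n nD; rewrite coefM coef1 -fg.
  have [-> |n0] := posnP n; first by rewrite !big_ord1 !coef_poly /= !mulr1.
  transitivity ((w ^+ p) ^+ n * \sum_(i < n.+1) f i * g (n - i)%N); last first.
    by rewrite fg gtn_eqF // mulr0.
  rewrite mulr_sumr; apply: eq_bigr => i _; have := ltn_ord i => ilt.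
  rewrite !coef_poly !ifT; try lia.
  have -> : (w ^+ p) ^+ n = (w ^+ p) ^+ i * (w ^+ p) ^+ (n - i).
    by rewrite -exprD subnKC // -ltnS.
  ring.
move=> /(_ D (leqnn _)); rewrite coefM coef1 => <-; apply: eq_bigr => i _.
by rewrite !coef_twist_poly // ltnS leq_subr.
Qed.

End Convolution.

Lemma sum_multiples (V : nmodType) m k (F : nat -> V) : (0 < m)%N ->
  (forall i, ~~ (m %| i)%N -> F i = 0) ->
  \sum_(i < (m * k).+1) F i = \sum_(j < k.+1) F (m * j)%N.
Proof.
move=> m0 F0; rewrite !big_ord_recr /=; congr (_ + _).
elim: k => [|k IH]; first by rewrite muln0 !big_ord0.
rewrite big_ord_recr -IH mulnS addnC big_split_ord /=; congr (_ + _).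
case: m m0 F0 {IH} => // m _ F0.
rewrite big_ord_recl /= addn0 big1 ?addr0 // => i _; apply: F0.
by rewrite dvdn_addr ?dvdn_mulr // gtnNdvd // /bump; have := ltn_ord i; lia.
Qed.

(** * The coefficients of A and 1/A *)

Section SineCoefficients.
Local Open Scope classical_set_scope.
Variable R : realType.
Local Notation K := R[i].

Lemma rho_prim_root m : (0 < m)%N -> m.-primitive_root (rho m ^+ 2 : K).
Proof.
move=> m0; have mR : 0 < m%:R :> R by rewrite ltr0n.
have rE j : (rho m ^+ 2) ^+ j = cis (j%:R * pi / m%:R *+ 2) :> K.
  rewrite -exprM -[rho m]/(cis (pi / m%:R)) cisX; congr cis.
  by rewrite natrM -mulr_natr; ring.
apply/andP; split=> //; apply/forallP => i; apply/eqP.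
rewrite unity_rootE rE; have ilt := ltn_ord i.
have [im|im] := eqVneq i.+1 m.
  by rewrite im [_ * pi]mulrC mulfK ?(lt0r_neq0 mR) // /cis cos2pi sin2pi eqxx.
(* For [i.+1 < m] the real part is [1 - 2 sin^2 x] with [0 < x < pi], hence less than 1. *)
apply/negbTE; rewrite eq_complex negb_and /= cos_mulr2n cos2sin2; apply/orP; left.
have s0 : 0 < sin (i.+1%:R * pi / m%:R : R).
  apply: sin_gt0_pi; rewrite divr_gt0 ?mulr_gt0 ?pi_gt0 ?ltr0n //=.
  rewrite ltr_pdivrMr // mulrC ltr_pM2l ?pi_gt0 // ltr_nat.
  by rewrite ltn_neqAle im.
by rewrite lt_eqF //; nra.
Qed.

(** Coefficients in [v] of [sin (pi sqrt v) / (pi sqrt v)], and in [cosecant_coef] those of its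
    inverse; [lambda ^+ 2 / 4] is [- pi^2]. *)
Definition sine_coef (l : nat) : K := (lambda ^+ 2 / 4) ^+ l / (2 * l).+1`!%:R.
Definition cosecant_coef (l : nat) : K :=
  (lambda ^+ 2 / 4) ^+ l * ratr (beta2 l / (2 * l)`!%:R).

Lemma lambda2E : lambda ^+ 2 / 4 = (- pi ^+ 2)%:C%C :> K.
Proof.
have -> : lambda ^+ 2 = (- pi ^+ 2)%:C%C * 4 :> K.
  have -> : 4 = (4 : R)%:C%C :> K by rewrite rmorph_nat.
  by apply/eqP; rewrite eq_complex /=; apply/andP; split; apply/eqP; ring.
by rewrite mulfK // pnatr_eq0.
Qed.

Lemma sine_cosecant_coef n :
  \sum_(i < n.+1) sine_coef i * cosecant_coef (n - i) = (n == 0)%:R.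
Proof.
have -> : (n == 0)%:R = (lambda ^+ 2 / 4) ^+ n * (n == 0)%:R :> K.
  by case: eqP => [->|]; rewrite ?mulr1 ?mulr0.
have -> : (n == 0)%:R = ratr (n == 0)%:R :> K by rewrite rmorph_nat.
rewrite -beta2_sinh rmorph_sum mulr_sumr (reindex_inj rev_ord_inj) /=.
apply: eq_bigr => i _; have ilt : (i <= n)%N by rewrite -ltnS.
rewrite subSS subKn // /sine_coef /cosecant_coef [in RHS]rmorphM /= fmorphV /= ratr_nat.
have -> : (lambda ^+ 2 / 4 : K) ^+ n =
    (lambda ^+ 2 / 4) ^+ (n - i) * (lambda ^+ 2 / 4) ^+ i.
  by rewrite -exprD subnK.
move: (_ ^+ (n - i)) (_ ^+ i) (ratr _) => x y z; ring.
Qed.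

(** The sign [(-1)^l], from replacing [1 + v / r^2] by [1 - v / r^2], and the [pi^(2l)] of
    [cvg_epoly_zeta2] combine to [(lambda^2 / 4)^l]. *)
Lemma ccvg_sine_coef l :
  ccvg (fun N => (epoly (fun M => - (qinv K M ^+ 2)) N)`_l) (sine_coef l).
Proof.
have := ccvg_real (@cvg_epoly_zeta2 R l).
move/(ccvgM (ccvg_cst ((-1) ^+ l))).
have -> : (-1) ^+ l * (pi ^+ (2 * l) / ((2 * l).+1)`!%:R : R)%:C%C = sine_coef l.
  rewrite /sine_coef lambda2E rmorphM fmorphV rmorph_nat mulrA; congr (_ / _).
  by rewrite exprM !rmorphXn rmorphN -exprMn mulN1r rmorphXn.
apply: ccvg_ext => N.
have -> : epoly (fun M => - (qinv K M ^+ 2)) N =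
    epoly (fun M => -1 * (qinv K M ^+ 2)) N.
  by apply: eq_bigr => r _; rewrite mulN1r.
rewrite coef_epolyZ; congr (_ * _).
rewrite -[LHS]coef_map; congr (nth 0 (polyseq _) l).
rewrite /epoly rmorph_prod; apply: eq_bigr => r _ /=.
rewrite rmorphD rmorph1 /= map_polyZ map_polyX; congr (_ + _ *: _).
by rewrite fmorphV rmorphXn rmorph_nat /qinv exprVn.
Qed.

(** For each integer [r], this is [prod_one_sub_prim_root] for [rho m ^+ 2] with [v / r^2]
    substituted for the variable. *)
Lemma prod_epoly_twist m N : (0 < m)%N ->
  \prod_(p < m) epoly (fun M => (rho m ^+ 2) ^+ p * - (qinv K M ^+ 2)) N =
  epoly (fun M => - (qinv K M ^+ (2 * m))) N \Po 'X^m.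
Proof.
move=> m0; rewrite /epoly exchange_big /= rmorph_prod; apply: eq_bigr => r _ /=.
rewrite comp_polyD comp_polyZ comp_polyX (comp_polyC 1).
have := congr1 (fun P => P \Po (qinv K r ^+ 2 *: 'X)) (prod_one_sub_prim_root m0 (rho_prim_root m0)).
rewrite rmorph_prod rmorphB rmorph1 /= comp_Xn_poly exprZn -exprM scaleNr => <-.
apply: eq_bigr => p _.
by rewrite comp_polyB (comp_polyC 1) comp_polyZ comp_polyX scalerA mulrN scaleNr.
Qed.

(** Coefficient [D] of both sides of [prod_epoly_twist], in the limit. It also shows that the
    twisted sine coefficients vanish off the multiples of [m]. *)
Lemma ccvg_twist_sine m D : (0 < m)%N ->
  ccvg (fun N => if (m %| D)%N then (epoly (fun M => - (qinv K M ^+ (2 * m))) N)`_(D %/ m) else 0)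
    (twist_coef m (rho m ^+ 2) sine_coef D).
Proof.
move=> m0.
apply: (@ccvg_ext _ (fun N => \sum_(c : {ffun 'I_m -> 'I_D.+1} | (\sum_(p < m) (c p : nat))%N == D)
     \prod_(p < m) ((epoly (fun M => - (qinv K M ^+ 2)) N)`_(c p) * ((rho m ^+ 2) ^+ p) ^+ c p))).
  move=> N; rewrite -(coef_comp_poly_Xn _ _ m0) -prod_epoly_twist // coef_prod_ffun.
  apply: eq_bigr => c _; apply: eq_bigr => p _.
  by rewrite coef_epolyZ mulrC.
apply: ccvg_sum => c _; apply: ccvg_prod => p.
by apply: ccvgM; [exact: ccvg_sine_coef | exact: ccvg_cst].
Qed.

End SineCoefficients.

(** * The limiting generating function and its coefficients *)

Section Assembly.
Local Open Scope classical_set_scope.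
Variables (R : realType) (m : nat) (t : R[i]).
Hypothesis m0 : (0 < m)%N.
Local Notation K := R[i].

(* Coefficients of [A] and of [1 / A]. *)
Let al j : K := twist_coef m (rho m ^+ 2) (@sine_coef R) (m * j).
Let bl j : K := twist_coef m (rho m ^+ 2) (@cosecant_coef R) (m * j).
Let s := den_lin t.
Let s' := num_lin t.

Lemma sinprod_coef_inv k : \sum_(j < k.+1) al j * bl (k - j) = (k == 0)%:R.
Proof.
pose F i : K := twist_coef m (rho m ^+ 2) (@sine_coef R) i *
  twist_coef m (rho m ^+ 2) (@cosecant_coef R) (m * k - i).
transitivity (\sum_(j < k.+1) F (m * j)%N).
  by apply: eq_bigr => j _; rewrite /F -mulnBr.
(* Indices not divisible by [m] may be added: there the sine coefficient is the limit of the zero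
   sequence. *)
rewrite -sum_multiples //; last first.
  move=> i mi; rewrite /F (_ : twist_coef _ _ _ i = 0) ?mul0r //.
  have := ccvg_twist_sine R i m0; rewrite (negbTE mi) => h.
  exact: ccvg_unique h (ccvg_cst _).
rewrite (twist_coef_inv _ _ _ (@sine_cosecant_coef R)).
by rewrite muln_eq0 gtn_eqF.
Qed.

Lemma ccvg_sinprod_coef j :
  ccvg (fun N => (epoly (fun M => - (qinv K M ^+ (2 * m))) N)`_j) (al j).
Proof.
have := ccvg_twist_sine R (m * j) m0.
by rewrite dvdn_mulr // mulKn.
Qed.

Lemma coef_qprod (p : {poly K}) N j :
  (qprod (qinv K) (2 * m) p N)`_j =
  p ^+ j * ((epoly (fun M => - (qinv K M ^+ (2 * m))) N)`_j)%:P.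
Proof.
transitivity ((epoly (fun M => p * (- (qinv K M ^+ (2 * m)))%:P) N)`_j).
  congr (nth 0 (polyseq _) j); apply: eq_bigr => M _.
  by rewrite mulrC mul_polyC scaleNr scaleNr.
rewrite coef_epolyZ -coef_map; congr (_ * nth 0 (polyseq _) j).
rewrite /epoly rmorph_prod; apply: eq_bigr => M _ /=.
by rewrite rmorphD rmorph1 /= map_polyZ map_polyX.
Qed.

(** The [S(k,n)] of the generating function; [zpoly k] is its coefficient of [z^k], a polynomial in
    [y]. *)
Definition zsum n k : K :=
  \sum_(c <- compositions n k) mzv_t t [seq (2 * m * x)%N | x <- c].

Definition zpoly k : {poly K} := \poly_(n < k.+1) zsum n k.

Lemma pccvg_gpoly k : pccvg (fun N => gpoly t (qinv K) (2 * m) N k) (zpoly k).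
Proof.
move=> n.
have -> : (zpoly k)`_n = zsum n k.
  rewrite coef_poly; case: ltnP => // kn.
  by rewrite /zsum compositions_gt // big_nil.
apply: (@ccvg_ext _ (fun N => gsum t (qinv K) (2 * m) N n k)).
  by move=> N; rewrite coef_gpoly.
(* Membership is kept under the sum because the positivity of the parts makes all exponents at least
   2. *)
rewrite /gsum /zsum big_seq.
apply: (@ccvg_ext _ (fun N => \sum_(c <- compositions n k | c \in compositions n k)
    qsum_t t (qinv K) N [seq (2 * m * x)%N | x <- c])).
  by move=> N; rewrite [RHS]big_seq.
apply: ccvg_sum => c; rewrite mem_compositions => /and3P[_ c0 _].
apply: ccvg_qsum_t; rewrite all_map; apply/allP => x /(allP c0) x0 /=.
by rewrite -mulnA leq_pmulr // muln_gt0 m0.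
Qed.

(** The coefficient of [z^k] in [gpoly_qprod], in the limit: the generating function times [A(s z)]
    is [A(s' z)]. *)
Lemma zpoly_conv k :
  \sum_(i < k.+1) zpoly i * (s ^+ (k - i) * (al (k - i))%:P) = s' ^+ k * (al k)%:P.
Proof.
have cvgq p j : pccvg (fun N => (qprod (qinv K) (2 * m) p N)`_j) (p ^+ j * (al j)%:P).
  apply: (@pccvg_ext _ (fun N => p ^+ j * ((epoly (fun M => - (qinv K M ^+ (2 * m))) N)`_j)%:P)).
    by move=> N; rewrite coef_qprod.
  by apply: pccvgM; [exact: pccvg_cst | apply: pccvg_polyC; exact: ccvg_sinprod_coef].
apply: (@pccvg_unique _ (fun N => (qprod (qinv K) (2 * m) s' N)`_k)); last exact: cvgq.
apply: (@pccvg_ext _ (fun N => \sum_(i < k.+1)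
   gpoly t (qinv K) (2 * m) N i * (qprod (qinv K) (2 * m) s N)`_(k - i))).
  move=> N; have := @gpoly_qprod K t (qinv K) (2 * m) k.+1 N k (leqnn _).
  rewrite coefM => <-; apply: eq_bigr => i _.
  by rewrite coef_poly ltn_ord.
by apply: pccvg_sum => i; apply: pccvgM; [exact: pccvg_gpoly | exact: cvgq].
Qed.

(** Multiplying by [B], a truncation of [1 / A(s z)], solves [zpoly_conv] for [zpoly]. *)
Lemma zpolyE k :
  zpoly k = \sum_(i < k.+1) (al i * bl (k - i)) *: (s' ^+ i * s ^+ (k - i)).
Proof.
pose U := \poly_(i < k.+1) zpoly i.
pose A (p : {poly K}) := \poly_(i < k.+1) (p ^+ i * (al i)%:P).
pose B := \poly_(i < k.+1) (s ^+ i * (bl i)%:P).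
have UA : eqX k.+1 (U * A s) (A s').
  move=> j jk; rewrite coefM coef_poly jk -zpoly_conv; apply: eq_bigr => i _.
  have ij := ltn_ord i.
  by rewrite !coef_poly !ifT //; lia.
have AB : eqX k.+1 (A s * B) 1.
  move=> j jk; rewrite coefM coef1.
  transitivity (s ^+ j * (\sum_(i < j.+1) al i * bl (j - i))%:P).
    rewrite rmorph_sum mulr_sumr; apply: eq_bigr => i _ /=.
    have ij := ltn_ord i.
    rewrite !coef_poly !ifT; try lia.
    have -> : s ^+ j = s ^+ i * s ^+ (j - i) by rewrite -exprD subnKC // -ltnS.
    by rewrite polyCM; ring.
  by rewrite sinprod_coef_inv; case: eqP => [->|]; rewrite ?mulr1 ?mulr0.
have : eqX k.+1 U (A s' * B).
  apply: (@eqX_trans _ _ (U * (A s * B))).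
    by rewrite -{1}[U]mulr1; apply: eqXM => //; exact: eqX_sym.
  by rewrite mulrA; apply: eqXM.
move=> /(_ k (leqnn _)); rewrite coefM coef_poly ltnSn => ->.
apply: eq_bigr => i _; have ik := ltn_ord i.
rewrite !coef_poly !ifT; try lia.
by rewrite -mul_polyC polyCM; ring.
Qed.

Lemma coef_den_linX k n : (s ^+ k)`_n = 'C(k, n)%:R * t ^+ n.
Proof.
rewrite /s /den_lin exprDn (eq_bigr (fun i : 'I_k.+1 => ('C(k, i)%:R * t ^+ i) *: 'X^i)).
  rewrite -(poly_def k.+1 (fun i => 'C(k, i)%:R * t ^+ i)) coef_poly.
  by case: ltnP => // kn; rewrite bin_small // mul0r.
by move=> i _; rewrite expr1n mul1r exprZn -scaler_nat scalerA.
Qed.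

(** Expanding [s' = s - y] binomially gives the terms ['C(i, u) (-y)^u s^(k-u)], and the
    coefficients of powers of [s = 1 + t y] are known. *)
Lemma coef_num_den_lin i k n : (i <= k)%N ->
  (s' ^+ i * s ^+ (k - i))`_n =
  \sum_(u < n.+1) 'C(i, u)%:R * (-1) ^+ u * ('C(k - u, n - u)%:R * t ^+ (n - u)).
Proof.
move=> ik; pose F u := 'C(i, u)%:R * (-1) ^+ u * ('C(k - u, n - u)%:R * t ^+ (n - u)).
have -> : (s' ^+ i * s ^+ (k - i))`_n = \sum_(u < i.+1) (if (n < u)%N then 0 else F u).
  rewrite /s' /num_lin -/s exprBn mulr_suml coef_sum; apply: eq_bigr => u _.
  have ui : (u <= i)%N by rewrite -ltnS.
  have -> : (-1) ^+ u * s ^+ (i - u) * 'X^u *+ 'C(i, u) * s ^+ (k - i) =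
     ('C(i, u)%:R * (-1) ^+ u) *: (s ^+ (k - u) * 'X^u).
    have -> : (k - u = (i - u) + (k - i))%N by lia.
    rewrite exprD -scalerA scaler_nat -[(-1) ^+ u *: _]mul_polyC rmorphXn rmorphN1.
    by rewrite mulrnAl; congr (_ *+ _); ring.
  rewrite coefZ coefMXn coef_den_linX; case: ltnP => // _; by rewrite mulr0.
transitivity (\sum_(u < n.+1 | (u <= i)%N) F u); last first.
  rewrite big_mkcond; apply: eq_bigr => u _; case: leqP => // iu.
  by rewrite bin_small // !mul0r.
transitivity (\sum_(u < i.+1 | (u <= n)%N) F u).
  by rewrite [RHS]big_mkcond; apply: eq_bigr => u _; rewrite ltnNge; case: leqP.
rewrite (big_ord_widen_cond (i + n).+1 (fun u => u <= n)%N F); last by lia.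
rewrite (big_ord_widen_cond (i + n).+1 (fun u => u <= i)%N F); last by lia.
by apply: eq_bigl => u; rewrite !ltnS andbC.
Qed.
Lemma sinprod_coef_expand k j : (j <= k)%N ->
  al (k - j) * bl j =
  (\sum_(np : {ffun 'I_m -> 'I_(m * j).+1} |
      (\sum_(p < m) (np p : nat))%N == (m * j)%N)
    \sum_(lp : {ffun 'I_m -> 'I_(m * (k - j)).+1} |
      (\sum_(p < m) (lp p : nat))%N == (m * (k - j))%N)
      ((\prod_(p < m)
          ratr (beta2 (np p) / (((2 * np p)`!)%:R * ((2 * lp p).+1`!)%:R)) : K) *
       rho m ^+ (\sum_(p < m) 2 * p * (np p + lp p))%N)) *
  (lambda ^+ (2 * k * m) / ((4 ^ (k * m))%:R)).
Proof.
move=> jk; set z : K := lambda ^+ 2 / 4.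
(* The [l_p] sum to [m (k - j)] and the [n_p] to [m j], so the powers of [z] carried by the single
   factors collect to these two. *)
have -> : lambda ^+ (2 * k * m) / (4 ^ (k * m))%:R = z ^+ (m * (k - j)) * z ^+ (m * j).
  rewrite -exprD -mulnDr subnK // /z expr_div_n -exprM natrX.
  by rewrite -mulnA [(m * k)%N]mulnC.
rewrite mulrC /al /bl /twist_coef big_distrlr /= mulr_suml.
apply: eq_bigr => np /eqP npE; rewrite mulr_suml; apply: eq_bigr => lp /eqP lpE.
rewrite -[X in z ^+ X]lpE -[X in _ * z ^+ X]npE -!prodrXr -!big_split /=.
apply: eq_bigr => p _.
rewrite /cosecant_coef /sine_coef -/z mulnDr exprD !exprM.
have -> (b : rat) (x y : nat) : ratr (b / (x%:R * y%:R)) = ratr (b / x%:R) / y%:R :> K.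
  by rewrite invfM mulrA rmorphM /= fmorphV /= ratr_nat.
set y := ((2 * lp p).+1`!)%:R^-1; set x := ratr _; clearbody x y; ring.
Qed.

Lemma zsumE n k : (0 < k)%N ->
  zsum n k = \sum_(1 <= i < n.+1)
    (\sum_(0 <= j < (k - i).+1) 'C(k - j, i)%:R * (al (k - j) * bl j))
    * (-1) ^+ i * 'C(k - i, n - i)%:R * t ^+ (n - i).
Proof.
move=> k0.
have -> : zsum n k = (zpoly k)`_n.
  rewrite coef_poly; case: ltnP => // kn.
  by rewrite /zsum compositions_gt // big_nil.
pose S u : K := \sum_(j < k.+1) 'C(k - j, u)%:R * (al (k - j) * bl j).
have -> : (zpoly k)`_n = \sum_(u < n.+1)
    S u * (-1) ^+ u * 'C(k - u, n - u)%:R * t ^+ (n - u).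
  rewrite zpolyE coef_sum.
  under eq_bigr => i _ 
    do rewrite coefZ coef_num_den_lin -1?ltnS // [al _ * bl _ * _]mulr_sumr.
  rewrite exchange_big; apply: eq_bigr => u _ /=.
  rewrite /S !mulr_suml (reindex_inj rev_ord_inj) /=; apply: eq_bigr => j _.
  have jk : (j <= k)%N by rewrite -ltnS.
  rewrite subSS subKn //.
  move: (al _) (bl _) => x y; ring.
(* The term [u = 0] drops, so the sum starts at 1: its binomials are 1, and it is the coefficient of
   [z^k], [k > 0], in [A] times [1 / A]. *)
have S0 : S 0%N = 0.
  rewrite /S (reindex_inj rev_ord_inj) /=.
  rewrite (eq_bigr (fun j : 'I_k.+1 => al j * bl (k - j))).
    by rewrite sinprod_coef_inv gtn_eqF.
  by move=> j _; rewrite bin0 mul1r subSS subKn // -ltnS.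
rewrite big_ord_recl /= S0 !mul0r add0r big_add1 /= big_mkord.
apply: eq_bigr => u _; rewrite /bump /= add1n.
congr (_ * _ * _ * _); rewrite big_mkord /S.
(* The added terms vanish: there [k - j < u.+1], so the binomial is 0. *)
rewrite [RHS](big_ord_widen k.+1 (fun j => 'C(k - j, u.+1)%:R * (al (k - j) * bl j))); last by lia.
rewrite [RHS]big_mkcond; apply: eq_bigr => j _; case: ltnP => // h.
rewrite bin_small ?mul0r //; have := ltn_ord j; lia.
Qed.

End Assembly.

Theorem theorem4p12 (R : realType) (k n m : nat) (t : R[i]) :
  (0 < n)%N -> (0 < m)%N -> (n <= k)%N ->
  \sum_(c : {ffun 'I_n -> 'I_k.+1} |
          [forall i, (0 < c i)%N] && ((\sum_(i < n) (c i : nat))%N == k))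
     mzv_t t [seq (2 * m * c i)%N | i : 'I_n]
  =
  (\sum_(1 <= i < n.+1)
     (\sum_(0 <= j < (k - i).+1)
        ('C(k - j, i))%:R *
        \sum_(np : {ffun 'I_m -> 'I_(m * j).+1} |
                (\sum_(p < m) (np p : nat))%N == (m * j)%N)
        \sum_(lp : {ffun 'I_m -> 'I_(m * (k - j)).+1} |
                (\sum_(p < m) (lp p : nat))%N == (m * (k - j))%N)
          ((\prod_(p < m)
               ratr (beta2 (np p) /
                     (((2 * np p)`!)%:R * ((2 * lp p).+1`!)%:R)) : R[i]) *
           rho m ^+ (\sum_(p < m) 2 * p * (np p + lp p))%N))
     * (-1) ^+ i * ('C(k - i, k - n))%:R * t ^+ (n - i))
  * lambda ^+ (2 * k * m) / ((4 ^ (k * m))%:R).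
Proof.
move=> n0 m0 nk.
transitivity (zsum m t n k).
  rewrite /zsum -(sum_compositions (fun s => mzv_t t [seq (2 * m * x)%N | x <- s])).
  apply: eq_bigr => c _; congr mzv_t.
  by rewrite /image_mem -map_comp; apply: eq_map => i.
rewrite zsumE //; last exact: leq_trans nk.
rewrite -mulrA mulr_suml big_nat [RHS]big_nat; apply: eq_bigr => i /andP[i1 iN].
(* Symmetry of the binomial coefficient, as [(k - i) - (n - i) = k - n]. *)
have -> : 'C(k - i, k - n) = 'C(k - i, n - i).
  rewrite -bin_sub; last by lia.
  by congr 'C(_, _); lia.
set L := lambda ^+ _ / _.
rewrite -!(mulrAC _ L); congr (_ * _ * _ * _); rewrite mulr_suml.
rewrite big_nat [RHS]big_nat; apply: eq_bigr => j /andP[_ jk].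
by rewrite -mulrA sinprod_coef_expand //; lia.
Qed.
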